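(* Let $H$ be a finite-dimensional Hopf algebra over $\mathbb{C}$ and let $n$ be a positive integer. Then: (1) $\sum_{k=0}^N (-1)^k \binom{N}{k} R_{nk}=0$ for some positive integer $N$ if and only if $n$ is divisible by $\mathrm{qexp}(H)$. (2) $\sum_{k=0}^N (-1)^k \binom{N}{k} T_{nk}=0$ for some positive integer $N$ if and only if $n$ is divisible by $\mathrm{qexp}(H)$. Thus $\mathrm{qexp}(H)$ may be defined as the smallest positive integer $n$ for which there is a positive integer $N$ with $\sum_{k=0}^N (-1)^k \binom{N}{k} R_{nk}=0$, and equally as the smallest positive integer $n$ for which there is a positive integer $N$ with $\sum_{k=0}^N (-1)^k \binom{N}{k} T_{nk}=0$.
   Context: All Hopf algebras are over $\mathbb{C}$. Let $H$ be a finite-dimensional Hopf algebra with multiplication $m$, comultiplication $\Delta$, unit map $\iota$, counit $\varepsilon$ and antipode $S$. The Drinfeld double $D(H)=H^{*cop}\otimes H$ is the quasitriangular Hopf algebra which contains $H$ and $H^{*cop}$ (the dual Hopf algebra with opposite comultiplication) as Hopf subalgebras, for which multiplication $H^{*cop}\otimes H\to D(H)$ is a linear isomorphism, and whose universal $R$-matrix is $R=\sum_i h_i\otimes h_i^*$, where $\{h_i\}$, $\{h_i^*\}$ are dual bases of $H$ and $H^*$ (so $R\Delta(x)=\Delta^{op}(x)R$ for $x\in D(H)$). Its Drinfeld element is $u=\sum_i S(h_i^* )h_i$, with $S$ here the antipode of $D(H)$. The quasi-exponent $\mathrm{qexp}(H)$ is the smallest positive integer $n$ such that $u^n$ is unipotent,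 i.e. $(1-u^n)^N=0$ for some positive integer $N$; it is known to be finite. Let $m_1=\mathrm{Id}$, $\Delta_1=\mathrm{Id}$, and for $n\ge 2$ let $m_n=m\circ(m_{n-1}\otimes \mathrm{Id}):H^{\otimes n}\to H$ and $\Delta_n=(\Delta_{n-1}\otimes \mathrm{Id})\circ\Delta:H\to H^{\otimes n}$. Let $T_n:H\to H$ be the linear map $T_n(h)=m_n\circ(\mathrm{Id}\otimes S^{-2}\otimes\cdots\otimes S^{-2n+2})\circ\Delta_n(h)$ for $n\ge 1$, with $T_0(h)=\varepsilon(h)1$. Let $R_n=R\,(\mathrm{Id}\otimes S^2)(R)\cdots(\mathrm{Id}\otimes S^{2n-2})(R)\in D(H)\otimes D(H)$ for $n\ge 1$ (with $S$ the antipode of $D(H)$), and $R_0=1\otimes 1$. *)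

(* Defs.v *)
From HB Require Import structures.
From mathcomp Require Import all_boot all_order all_algebra all_field.
From mathcomp Require Import boolp.
Set Implicit Arguments.
Unset Strict Implicit.
Unset Printing Implicit Defensive.
Import GRing.Theory.
Local Open Scope ring_scope.

Section Tensor.
Variable F : fieldType.

(* The matrix t stands for \sum_(i, j) t i j *: (e_i ⊗ e'_j), where e and e'
   are the library bases of U and V. *)
Definition tens (U V : vectType F) : Type := 'M[F]_(\dim {:U}, \dim {:V}).
HB.instance Definition _ (U V : vectType F) :=
  Vector.copy (tens U V) 'M[F]_(\dim {:U}, \dim {:V}).

Definition tpure (U V : vectType F) (u : U) (v : V) : tens U V :=
  \matrix_(i, j) (coord (vbasis {:U}) i u * coord (vbasis {:V}) j v).

(* Meaningful when b is bilinear, see tliftE. *)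
Definition tlift (U V W : vectType F) (b : U -> V -> W) : 'Hom(tens U V, W) :=
  linfun (fun t : tens U V =>
    \sum_i \sum_j t i j *: b (vbasis {:U})`_i (vbasis {:V})`_j).

End Tensor.

Notation "u ⊗ v" := (tpure u v) (at level 40, left associativity) : ring_scope.

Section TensorTheory.
Variable F : fieldType.
Implicit Types U V W X : vectType F.

Definition bilin U V W (b : U -> V -> W) : Prop :=
  (forall u, linear (b u)) /\ (forall v, linear (b^~ v)).

Fact tlift_linear U V W (b : U -> V -> W) :
  linear (fun t : tens U V =>
    \sum_i \sum_j t i j *: b (vbasis {:U})`_i (vbasis {:V})`_j).
Proof.
move=> k s t; rewrite scaler_sumr -big_split; apply: eq_bigr => i _.
rewrite scaler_sumr -big_split; apply: eq_bigr => j _ /=.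
by rewrite !mxE scalerDl scalerA.
Qed.

Lemma linfun_linear V W (f : V -> W) : linear f -> linfun f =1 f.
Proof.
move=> fL x; pose g : {linear V -> W} :=
  HB.pack f (GRing.isSemilinear.Build F V W _ f (GRing.semilinear_linear fL)).
by rewrite -[f]/(g : V -> W) lfunE.
Qed.

Lemma tliftEmx U V W (b : U -> V -> W) (t : tens U V) :
  tlift b t = \sum_i \sum_j t i j *: b (vbasis {:U})`_i (vbasis {:V})`_j.
Proof. by rewrite /tlift linfun_linear //; exact: tlift_linear. Qed.

Lemma linear_sumZ V W (f : V -> W) n (c : 'I_n -> F) (x : 'I_n -> V) :
  linear f -> f (\sum_i c i *: x i) = \sum_i c i *: f (x i).
Proof.
move=> fL; rewrite -(linfun_linear fL) linear_sum.
by apply: eq_bigr => i _; rewrite linearZ /= linfun_linear.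
Qed.

Lemma coord_fullv V (v : V) :
  v = \sum_i coord (vbasis {:V}) i v *: (vbasis {:V})`_i.
Proof. by rewrite -coord_vbasis ?memvf. Qed.

Lemma tliftE U V W (b : U -> V -> W) u v : bilin b -> tlift b (u ⊗ v) = b u v.
Proof.
case=> bl br; rewrite tliftEmx.
rewrite [in RHS](coord_fullv u) (linear_sumZ _ _ (br v)); apply: eq_bigr => i _.
rewrite [in RHS](coord_fullv v) (linear_sumZ _ _ (bl _)) scaler_sumr.
by apply: eq_bigr => j _; rewrite mxE scalerA.
Qed.

Lemma tpureP U V : bilin (@tpure F U V).
Proof.
split=> [u k v v'|v k u u']; apply/matrixP=> i j; rewrite !mxE linearP /=.
  by rewrite mulrDr mulrCA.
by rewrite mulrDl mulrA.
Qed.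

Lemma tpureDl U V (u u' : U) (v : V) : (u + u') ⊗ v = u ⊗ v + u' ⊗ v.
Proof. by have := (tpureP U V).2 v 1 u u'; rewrite !scale1r. Qed.
Lemma tpureDr U V (u : U) (v v' : V) : u ⊗ (v + v') = u ⊗ v + u ⊗ v'.
Proof. by have := (tpureP U V).1 u 1 v v'; rewrite !scale1r. Qed.
Lemma tpure0l U V (v : V) : (0 : U) ⊗ v = 0.
Proof. by apply/matrixP=> i j; rewrite !mxE linear0 mul0r. Qed.
Lemma tpure0r U V (u : U) : u ⊗ (0 : V) = 0.
Proof. by apply/matrixP=> i j; rewrite !mxE linear0 mulr0. Qed.
Lemma tpureZl U V k (u : U) (v : V) : (k *: u) ⊗ v = k *: (u ⊗ v).
Proof. by have := (tpureP U V).2 v k u 0; rewrite tpure0l !addr0. Qed.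
Lemma tpureZr U V k (u : U) (v : V) : u ⊗ (k *: v) = k *: (u ⊗ v).
Proof. by have := (tpureP U V).1 u k v 0; rewrite tpure0r !addr0. Qed.

Lemma tens_basis U V (t : tens U V) :
  t = \sum_i \sum_j t i j *: ((vbasis {:U})`_i ⊗ (vbasis {:V})`_j).
Proof.
apply/matrixP=> i j; rewrite summxE (bigD1 i) //= summxE (bigD1 j) //=.
have bU := basis_free (vbasisP {:U}); have bV := basis_free (vbasisP {:V}).
rewrite !mxE !coord_free // !eqxx !mulr1 big1 ?addr0; last first.
  move=> j' nj; rewrite !mxE !coord_free //.
  by rewrite (negPf nj) !mulr0.
rewrite big1 ?addr0 // => i' ni; rewrite summxE big1 // => j' _.
by rewrite !mxE !coord_free // (negPf ni) mul0r mulr0.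
Qed.

Lemma tens_ind U V (P : tens U V -> Prop) :
  (forall u v, P (u ⊗ v)) -> (forall s t, P s -> P t -> P (s + t)) ->
  forall t, P t.
Proof.
move=> Pp PD t; have P0 : P 0 by rewrite -(tpure0r V (0 : U)).
rewrite (tens_basis t); apply: big_ind => // i _; apply: big_ind => // j _.
by rewrite -tpureZl.
Qed.

(* Universal property, uniqueness part. *)
Lemma tens_lfunP U V W (f g : 'Hom(tens U V, W)) :
  (forall u v, f (u ⊗ v) = g (u ⊗ v)) -> f = g.
Proof.
move=> fg; apply/lfunP; elim/tens_ind => // s t Hs Ht.
by rewrite !linearD /= Hs Ht.
Qed.

Definition tmap U V U' V' (f : 'Hom(U, U')) (g : 'Hom(V, V')) :
  'Hom(tens U V, tens U' V') := tlift (fun u v => f u ⊗ g v).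

Definition tswap U V : 'Hom(tens U V, tens V U) := tlift (fun u v => v ⊗ u).

Definition tassoc U V W :
    'Hom(tens (tens U V) W, tens U (tens V W)) :=
  tlift (fun t w => tlift (fun u v => u ⊗ (v ⊗ w)) t).

Lemma tmapE U V U' V' (f : 'Hom(U, U')) (g : 'Hom(V, V')) u v :
  tmap f g (u ⊗ v) = f u ⊗ g v.
Proof.
rewrite tliftE //; split=> [x k y z|x k y z]; rewrite linearP /=.
  by rewrite tpureDr tpureZr.
by rewrite tpureDl tpureZl.
Qed.

Lemma tswapE U V (u : U) (v : V) : tswap U V (u ⊗ v) = v ⊗ u.
Proof.
rewrite tliftE //; split=> [x k y z|x k y z]; first by rewrite tpureDl tpureZl.
by rewrite tpureDr tpureZr.
Qed.

Lemma tassocE U V W (u : U) (v : V) (w : W) :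
  tassoc U V W ((u ⊗ v) ⊗ w) = u ⊗ (v ⊗ w).
Proof.
have H w' : bilin (fun (u : U) (v : V) => u ⊗ (v ⊗ w')).
  by split=> x k y z; rewrite ?(tpureDl, tpureDr, tpureZl, tpureZr).
rewrite tliftE ?tliftE //; split=> [t k y z|x k s t]; last by rewrite linearP.
elim/tens_ind: t => [a b|s t Hs Ht].
  by rewrite !tliftE // !(tpureDl, tpureDr, tpureZl, tpureZr).
by rewrite !linearD /= Hs Ht addrACA.
Qed.

End TensorTheory.

Arguments tswap {F U V}.
Arguments tassoc {F U V W}.

Section TensorAlgebra.
Variables (F : fieldType) (A B : falgType F).

Definition tensmul (s t : tens A B) : tens A B :=
  tlift (fun a b => tmap (amull a) (amull b)) s t.

Lemma tensmulE a b c d :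
  tensmul (a ⊗ b) (c ⊗ d) = (a * c) ⊗ (b * d).
Proof.
rewrite /tensmul tliftE ?tmapE ?lfunE //=.
split=> [x k y z|x k y z]; apply/tens_lfunP => u v.
  by rewrite add_lfunE scale_lfunE !tmapE !lfunE /= mulrDl -scalerAl tpureDr tpureZr.
by rewrite add_lfunE scale_lfunE !tmapE !lfunE /= mulrDl -scalerAl tpureDl tpureZl.
Qed.

Lemma tensmulDl : left_distributive tensmul +%R.
Proof. by move=> s t r; rewrite /tensmul linearD add_lfunE. Qed.
Lemma tensmulDr : right_distributive tensmul +%R.
Proof. by move=> s t r; rewrite /tensmul linearD. Qed.

Lemma tensmulA : associative tensmul.
Proof.
move=> r s t; elim/tens_ind: r => [a b|? ? H1 H2]; last first.
  by rewrite !tensmulDl H1 H2.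
elim/tens_ind: s => [c d|? ? H1 H2]; last first.
  by rewrite !(tensmulDl, tensmulDr) H1 H2.
elim/tens_ind: t => [e f|? ? H1 H2]; last by rewrite !tensmulDr H1 H2.
by rewrite !tensmulE !mulrA.
Qed.

Lemma tensmul1l : left_id (1 ⊗ 1) tensmul.
Proof.
by elim/tens_ind => [a b|? ? H1 H2]; rewrite ?tensmulE ?mul1r // tensmulDr H1 H2.
Qed.
Lemma tensmul1r : right_id (1 ⊗ 1) tensmul.
Proof.
by elim/tens_ind => [a b|? ? H1 H2]; rewrite ?tensmulE ?mulr1 // tensmulDl H1 H2.
Qed.

Lemma fullv_coord_neq0 (V : vectType F) (v : V) :
  v != 0 -> exists i, coord (vbasis {:V}) i v != 0.
Proof.
move=> v0; apply/existsP; apply: contraNT v0 => /existsPn H.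
rewrite (coord_fullv v) big1 // => i _.
by have /negPn/eqP -> := H i; rewrite scale0r.
Qed.

Lemma tens1_neq0 : (1 : A) ⊗ (1 : B) != 0.
Proof.
have [i Hi] := fullv_coord_neq0 (oner_neq0 A).
have [j Hj] := fullv_coord_neq0 (oner_neq0 B).
apply/eqP => /matrixP/(_ i j); rewrite !mxE => /eqP.
by rewrite mulf_eq0 (negPf Hi) (negPf Hj).
Qed.

HB.instance Definition _ := GRing.Zmodule_isNzRing.Build (tens A B)
  tensmulA tensmul1l tensmul1r tensmulDl tensmulDr tens1_neq0.

Lemma tensE a b c d : (a ⊗ b : tens A B) * (c ⊗ d) = (a * c) ⊗ (b * d).
Proof. exact: tensmulE. Qed.

Fact tens_scalerAl (k : F) (s t : tens A B) : k *: (s * t) = (k *: s) * t.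
Proof. by rewrite /GRing.mul /= /tensmul linearZ scale_lfunE. Qed.
Fact tens_scalerAr (k : F) (s t : tens A B) : k *: (s * t) = s * (k *: t).
Proof. by rewrite /GRing.mul /= /tensmul linearZ. Qed.

HB.instance Definition _ := GRing.Lmodule_isLalgebra.Build F (tens A B)
  tens_scalerAl.
HB.instance Definition _ := GRing.Lalgebra_isAlgebra.Build F (tens A B)
  tens_scalerAr.
HB.instance Definition _ := Algebra_isFalgebra.Build F (tens A B).

End TensorAlgebra.

Definition mulm {F : fieldType} {A : falgType F} : 'Hom(tens A A, A) :=
  tlift (fun a b => a * b).

Lemma mulmE (F : fieldType) (A : falgType F) (a b : A) : mulm (a ⊗ b) = a * b.
Proof.
rewrite tliftE //; split=> x k y z; first by rewrite mulrDr scalerAr.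
by rewrite mulrDl scalerAl.
Qed.

HB.mixin Record isHopf (F : fieldType) H of Falgebra F H := {
  comul : 'Hom(H, tens H H);
  counit : 'Hom(H, F^o);
  antipode : 'End(H);
  comulA : forall x, tassoc (tmap comul \1%VF (comul x))
                     = tmap \1%VF comul (comul x);
  counitl : forall x, tlift (fun a b => (counit a : F) *: b) (comul x) = x;
  counitr : forall x, tlift (fun a b => (counit b : F) *: a) (comul x) = x;
  comul1 : comul 1 = 1;
  comulM : forall x y, comul (x * y) = comul x * comul y;
  counit1 : counit 1 = 1;
  counitM : forall x y, counit (x * y) = counit x * counit y;
  antipodel : forall x, mulm (tmap antipode \1%VF (comul x)) = (counit x : F)%:A;
  antipoder : forall x, mulm (tmap \1%VF antipode (comul x)) = (counit x : F)%:A
}.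

#[short(type="hopfType")]
HB.structure Definition Hopf (F : fieldType) :=
  { H of Falgebra F H & isHopf F H }.

Arguments comul {F s}.
Arguments counit {F s}.
Arguments antipode {F s}.

Definition dual (F : fieldType) (V : vectType F) : Type := 'Hom(V, F^o).

Section Dual.
Variables (F : fieldType) (H : hopfType F).

HB.instance Definition _ := Vector.copy (dual H) 'Hom(H, F^o).
Implicit Types (f g h : dual H) (x y z : H).

Definition dualE f x : F := (f : 'Hom(H, F^o)) x.

Definition tev (U V : vectType F) (f : 'Hom(U, F^o)) (g : 'Hom(V, F^o)) :
  'Hom(tens U V, F^o) := tlift (fun u v => f u * g v : F^o).

Lemma tevE (U V : vectType F) (f : 'Hom(U, F^o)) (g : 'Hom(V, F^o)) u v :
  tev f g (u ⊗ v) = f u * g v.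
Proof.
rewrite tliftE //; split=> x k y z; rewrite linearP /=.
  by rewrite mulrDr /GRing.scale /= mulrCA.
by rewrite mulrDl /GRing.scale /= mulrA.
Qed.

Definition conv f g : dual H := (tev f g \o comul)%VF.

Lemma tens_sum (U V : vectType F) (t : tens U V) :
  exists s : seq (U * V), t = \sum_(p <- s) p.1 ⊗ p.2.
Proof.
elim/tens_ind: t => [u v|s t [ls ->] [lt ->]].
  by exists [:: (u, v)]; rewrite big_seq1.
by exists (ls ++ lt); rewrite big_cat.
Qed.

Lemma convE f g x s : comul x = \sum_(p <- s) p.1 ⊗ p.2 ->
  conv f g x = \sum_(p <- s) f p.1 * g p.2.
Proof.
move=> Dx; rewrite comp_lfunE Dx linear_sum.
by apply: eq_bigr => p _ /=; rewrite tevE.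
Qed.

Lemma convDl : left_distributive conv +%R.
Proof.
move=> f g h; apply/lfunP => x; have [s Dx] := tens_sum (comul x).
rewrite add_lfunE !(convE _ _ Dx) -big_split; apply: eq_bigr => p _ /=.
by rewrite add_lfunE mulrDl.
Qed.

Lemma convDr : right_distributive conv +%R.
Proof.
move=> f g h; apply/lfunP => x; have [s Dx] := tens_sum (comul x).
rewrite add_lfunE !(convE _ _ Dx) -big_split; apply: eq_bigr => p _ /=.
by rewrite add_lfunE mulrDr.
Qed.

Lemma convZl k f g : k *: conv f g = conv (k *: f) g.
Proof.
apply/lfunP => x; have [s Dx] := tens_sum (comul x).
rewrite scale_lfunE !(convE _ _ Dx) scaler_sumr; apply: eq_bigr => p _ /=.
by rewrite scale_lfunE /GRing.scale /= mulrA.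
Qed.

Lemma convZr k f g : k *: conv f g = conv f (k *: g).
Proof.
apply/lfunP => x; have [s Dx] := tens_sum (comul x).
rewrite scale_lfunE !(convE _ _ Dx) scaler_sumr; apply: eq_bigr => p _ /=.
by rewrite scale_lfunE /GRing.scale /= mulrCA.
Qed.

Lemma convA : associative conv.
Proof.
move=> f g h; apply/lfunP => x; rewrite !comp_lfunE.
have -> : tev (conv f g) h (comul x) =
          tev (tev f g) h (tmap comul \1%VF (comul x)).
  elim/tens_ind: (comul x) => [a b|s t Hs Ht]; last by rewrite !linearD /= Hs Ht.
  by rewrite tmapE !tevE comp_lfunE id_lfunE.
have -> : tev f (conv g h) (comul x) =
          tev f (tev g h) (tmap \1%VF comul (comul x)).
  elim/tens_ind: (comul x) => [a b|s t Hs Ht]; last by rewrite !linearD /= Hs Ht.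
  by rewrite tmapE !tevE comp_lfunE id_lfunE.
rewrite -comulA; elim/tens_ind: (tmap _ _ _) => [t c|s t Hs Ht]; last first.
  by rewrite !linearD /= Hs Ht.
elim/tens_ind: t => [a b|s t Hs Ht].
  by rewrite tassocE !tevE mulrA.
by rewrite tpureDl !linearD /= Hs Ht.
Qed.

Lemma tliftE_sum (U V W : vectType F) (b : U -> V -> W) s : bilin b ->
  tlift b (\sum_(p <- s) p.1 ⊗ p.2) = \sum_(p <- s) b p.1 p.2.
Proof. by move=> bb; rewrite linear_sum; apply: eq_bigr => p _; exact: tliftE. Qed.

Lemma bilin_scalel (U V : vectType F) (f : 'Hom(U, F^o)) :
  bilin (fun (a : U) (b : V) => (f a : F) *: b).
Proof.
split=> [a k b c|a k b c]; first by rewrite scalerDr !scalerA mulrC.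
by rewrite linearP /= scalerDl scalerA.
Qed.

Lemma bilin_scaler (U V : vectType F) (f : 'Hom(V, F^o)) :
  bilin (fun (a : U) (b : V) => (f b : F) *: a).
Proof.
split=> [a k b c|a k b c]; last by rewrite scalerDr !scalerA mulrC.
by rewrite linearP /= scalerDl scalerA.
Qed.

Lemma conv1l : left_id (counit : dual H) conv.
Proof.
move=> f; apply/lfunP => x; have [s Dx] := tens_sum (comul x).
rewrite (convE _ _ Dx) -[in RHS](counitl x) Dx tliftE_sum; last exact: bilin_scalel.
by rewrite linear_sum; apply: eq_bigr => p _; rewrite linearZ.
Qed.

Lemma conv1r : right_id (counit : dual H) conv.
Proof.
move=> f; apply/lfunP => x; have [s Dx] := tens_sum (comul x).
rewrite (convE _ _ Dx) -[in RHS](counitr x) Dx tliftE_sum; last exact: bilin_scaler.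
by rewrite linear_sum; apply: eq_bigr => p _; rewrite linearZ /= mulrC.
Qed.

Lemma counit_neq0 : (counit : dual H) != 0.
Proof.
apply/eqP => /lfunP/(_ 1); rewrite counit1 zero_lfunE => /eqP.
by rewrite oner_eq0.
Qed.

HB.instance Definition _ := GRing.Zmodule_isNzRing.Build (dual H)
  convA conv1l conv1r convDl convDr counit_neq0.
HB.instance Definition _ := GRing.Lmodule_isLalgebra.Build F (dual H) convZl.
HB.instance Definition _ := GRing.Lalgebra_isAlgebra.Build F (dual H) convZr.
HB.instance Definition _ := Algebra_isFalgebra.Build F (dual H).

Definition dbasis (i : 'I_(\dim {:H})) : dual H :=
  linfun (fun x => coord (vbasis {:H}) i x : F^o).

(* The transpose of the multiplication of H, see dual_comulE. *)
Definition dual_comul : 'Hom(dual H, tens (dual H) (dual H)) :=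
  linfun (fun f : dual H => \sum_(i < \dim {:H}) \sum_(j < \dim {:H})
    (f ((vbasis {:H})`_i * (vbasis {:H})`_j) : F) *: (dbasis i ⊗ dbasis j)).

Definition dual_counit : 'Hom(dual H, F^o) := linfun (fun f : dual H => f 1).

Definition dual_antipode : 'End(dual H) :=
  linfun (fun f : dual H => (f \o antipode)%VF : dual H).

Lemma dual_counitE f : dual_counit f = f 1.
Proof.
by rewrite linfun_linear // => k g h; rewrite add_lfunE scale_lfunE.
Qed.

Lemma dual_antipodeE f x : (dual_antipode f : dual H) x = f (antipode x).
Proof.
rewrite linfun_linear ?comp_lfunE // => k g h; apply/lfunP => y.
by rewrite comp_lfunE !add_lfunE !scale_lfunE !comp_lfunE.
Qed.

Definition evl (W : vectType F) x : 'Hom(tens (dual H) W, W) :=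
  tlift (fun f w => (f x : F) *: w).

Lemma evlE (W : vectType F) x f (w : W) : evl W x (f ⊗ w) = (f x : F) *: w.
Proof.
rewrite tliftE //; split=> [a k b c|a k b c]; first by rewrite scalerDr !scalerA mulrC.
by rewrite add_lfunE scale_lfunE scalerDl scalerA.
Qed.

Lemma dbasisE i x : dbasis i x = coord (vbasis {:H}) i x.
Proof. by rewrite linfun_linear // => k y z; rewrite linearP. Qed.

Lemma dual_coord f : f = \sum_(i < \dim {:H}) (f (vbasis {:H})`_i : F) *: dbasis i.
Proof.
apply/lfunP => x; rewrite sum_lfunE {1}(coord_fullv x) linear_sum.
apply: eq_bigr => i _; rewrite linearZ scale_lfunE dbasisE /= /GRing.scale /=.
exact: mulrC.
Qed.

Lemma evl_inj (W : vectType F) (s t : tens (dual H) W) :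
  (forall x, evl W x s = evl W x t) -> s = t.
Proof.
have K r : r = \sum_i dbasis i ⊗ evl W (vbasis {:H})`_i r.
  elim/tens_ind: r => [f w|a b Ha Hb]; last first.
    rewrite {1}Ha {1}Hb -big_split; apply: eq_bigr => i _ /=.
    by rewrite linearD /= tpureDr.
  transitivity ((\sum_(i < \dim {:H}) (f (vbasis {:H})`_i : F) *: dbasis i) ⊗ w).
    by rewrite -dual_coord.
  elim/big_rec2: _ => [|i a b _ <-]; first by rewrite tpure0l.
  by rewrite tpureDl evlE tpureZl tpureZr.
by move=> st; rewrite (K s) (K t); apply: eq_bigr => i _; rewrite st.
Qed.

Definition ev2 x y (s : tens (dual H) (dual H)) : F := evl (dual H) x s y.

Lemma ev2E x y s :
  ev2 x y (\sum_(p <- s) p.1 ⊗ p.2) = \sum_(p <- s) p.1 x * p.2 y.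
Proof.
rewrite /ev2 linear_sum sum_lfunE; apply: eq_bigr => p _ /=.
by rewrite evlE scale_lfunE.
Qed.

Lemma ev2_inj s t : (forall x y, ev2 x y s = ev2 x y t) -> s = t.
Proof. by move=> st; apply: evl_inj => x; apply/lfunP => y; exact: st. Qed.

Lemma dual_comulE f x y : ev2 x y (dual_comul f) = f (x * y).
Proof.
rewrite linfun_linear; last first.
  move=> k g h; rewrite scaler_sumr -big_split; apply: eq_bigr => i _.
  rewrite scaler_sumr -big_split; apply: eq_bigr => j _ /=.
  by rewrite add_lfunE scale_lfunE scalerDl scalerA.
rewrite /ev2 linear_sum sum_lfunE {2}(coord_fullv x) mulr_suml linear_sum.
apply: eq_bigr => i _; rewrite linear_sum sum_lfunE {2}(coord_fullv y).
rewrite mulr_sumr linear_sum; apply: eq_bigr => j _ /=.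
rewrite linearZ /= evlE !scale_lfunE !dbasisE -scalerAl -scalerAr !linearZ /=.
by rewrite /GRing.scale /=; congr (_ * _); exact: mulrC.
Qed.

Lemma dual_comul_sum f s : dual_comul f = \sum_(p <- s) p.1 ⊗ p.2 ->
  forall x y, f (x * y) = \sum_(p <- s) p.1 x * p.2 y.
Proof. by move=> Df x y; rewrite -dual_comulE Df ev2E. Qed.

Lemma evl_tassoc x y z (t : tens (dual H) (dual H)) f :
  ev2 y z (evl _ x (tassoc (t ⊗ f))) = ev2 x y t * f z.
Proof.
elim/tens_ind: t => [a b|s t Hs Ht].
  by rewrite /ev2 tassocE !evlE linearZ /= evlE !scale_lfunE; exact: mulrA.
rewrite tpureDl /ev2 !linearD /= !add_lfunE mulrDl; congr (_ + _).
  exact: Hs.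
exact: Ht.
Qed.

Lemma ev2D x y : {morph ev2 x y : s t / s + t}.
Proof. by move=> s t; rewrite /ev2 linearD add_lfunE. Qed.

Lemma ev2_0 x y : ev2 x y 0 = 0.
Proof. by rewrite /ev2 linear0 zero_lfunE. Qed.

Lemma dual_comulA f : tassoc (tmap dual_comul \1%VF (dual_comul f))
                      = tmap \1%VF dual_comul (dual_comul f).
Proof.
have [s Df] := tens_sum (dual_comul f).
apply: evl_inj => x; apply: ev2_inj => y z.
transitivity (f (x * y * z)).
  rewrite (dual_comul_sum Df) Df !linear_sum.
  elim: s {Df} => [|p s IHs]; first by rewrite !big_nil ev2_0.
  rewrite !big_cons ev2D IHs /= tmapE evl_tassoc id_lfunE dual_comulE.
  by [].
rewrite -mulrA (dual_comul_sum Df) Df !linear_sum.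
elim: s {Df} => [|p s IHs]; first by rewrite !big_nil ev2_0.
rewrite !big_cons ev2D -IHs /= tmapE evlE id_lfunE; congr (_ + _).
by rewrite /ev2 linearZ scale_lfunE -/(ev2 y z _) dual_comulE.
Qed.

Lemma dual_counitl f : tlift (fun a b => (dual_counit a : F) *: b) (dual_comul f) = f.
Proof.
have [s Df] := tens_sum (dual_comul f).
rewrite Df tliftE_sum; last exact: bilin_scalel.
apply/lfunP => x; rewrite sum_lfunE -{2}[x]mul1r (dual_comul_sum Df).
by apply: eq_bigr => p _; rewrite scale_lfunE dual_counitE.
Qed.

Lemma dual_counitr f : tlift (fun a b => (dual_counit b : F) *: a) (dual_comul f) = f.
Proof.
have [s Df] := tens_sum (dual_comul f).
rewrite Df tliftE_sum; last exact: bilin_scaler.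
apply/lfunP => x; rewrite sum_lfunE -{2}[x]mulr1 (dual_comul_sum Df).
by apply: eq_bigr => p _; rewrite scale_lfunE dual_counitE [RHS]mulrC.
Qed.

Lemma dual_comul1 : dual_comul 1 = 1.
Proof.
apply: ev2_inj => x y; rewrite dual_comulE /ev2 evlE scale_lfunE.
exact: counitM.
Qed.

Lemma dual_counit1 : dual_counit 1 = 1.
Proof. by rewrite dual_counitE; exact: counit1. Qed.

Lemma dual_counitM f g : dual_counit (f * g) = dual_counit f * dual_counit g.
Proof.
rewrite !dual_counitE comp_lfunE comul1; exact: tevE.
Qed.

Lemma dual_comulM f g : dual_comul (f * g) = dual_comul f * dual_comul g.
Proof.
apply: ev2_inj => x y; rewrite dual_comulE.
have [sx Dx] := tens_sum (comul x); have [sy Dy] := tens_sum (comul y).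
have [sf Df] := tens_sum (dual_comul f); have [sg Dg] := tens_sum (dual_comul g).
rewrite comp_lfunE comulM Dx Dy Df Dg !mulr_suml.
rewrite linear_sum /=.
transitivity (\sum_(p <- sf) \sum_(q <- sg) \sum_(r <- sx) \sum_(s <- sy)
   (p.1 r.1 * q.1 r.2) * (p.2 s.1 * q.2 s.2)); last first.
  symmetry; rewrite /ev2 linear_sum sum_lfunE; apply: eq_bigr => p _.
  rewrite mulr_sumr linear_sum sum_lfunE; apply: eq_bigr => q _ /=.
  rewrite tensE evlE scale_lfunE (convE _ _ Dx) (convE _ _ Dy) /GRing.scale /=.
  by rewrite mulr_suml; apply: eq_bigr => r _; rewrite mulr_sumr.
under [RHS]eq_bigr do rewrite exchange_big /=.
rewrite [RHS]exchange_big /=; apply: eq_bigr => r _.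
rewrite mulr_sumr linear_sum /=.
under [RHS]eq_bigr do rewrite exchange_big /=.
rewrite [RHS]exchange_big /=; apply: eq_bigr => s _.
rewrite tensE tevE (dual_comul_sum Df) (dual_comul_sum Dg) mulr_suml.
apply: eq_bigr => p _; rewrite mulr_sumr; apply: eq_bigr => q _.
by rewrite mulrACA.
Qed.

Lemma dual_antipodel f :
  mulm (tmap dual_antipode \1%VF (dual_comul f)) = (dual_counit f : F)%:A.
Proof.
apply/lfunP => x; have [sx Dx] := tens_sum (comul x).
have [sf Df] := tens_sum (dual_comul f); rewrite Df !linear_sum sum_lfunE.
rewrite scale_lfunE dual_counitE.
transitivity (f (mulm (tmap antipode \1%VF (comul x)))); last first.
  by rewrite antipodel linearZ /= /GRing.scale /= mulrC.
rewrite Dx !linear_sum /=.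
under [RHS]eq_bigr do rewrite tmapE mulmE (dual_comul_sum Df).
rewrite [RHS]exchange_big /=; apply: eq_bigr => p _.
rewrite tmapE mulmE (convE _ _ Dx); apply: eq_bigr => r _.
by rewrite !id_lfunE dual_antipodeE.
Qed.

Lemma dual_antipoder f :
  mulm (tmap \1%VF dual_antipode (dual_comul f)) = (dual_counit f : F)%:A.
Proof.
apply/lfunP => x; have [sx Dx] := tens_sum (comul x).
have [sf Df] := tens_sum (dual_comul f); rewrite Df !linear_sum sum_lfunE.
rewrite scale_lfunE dual_counitE.
transitivity (f (mulm (tmap \1%VF antipode (comul x)))); last first.
  by rewrite antipoder linearZ /= /GRing.scale /= mulrC.
rewrite Dx !linear_sum /=.
under [RHS]eq_bigr do rewrite tmapE mulmE (dual_comul_sum Df).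
rewrite [RHS]exchange_big /=; apply: eq_bigr => p _.
rewrite tmapE mulmE (convE _ _ Dx); apply: eq_bigr => r _.
by rewrite !id_lfunE dual_antipodeE.
Qed.

HB.instance Definition _ := isHopf.Build F (dual H)
  dual_comulA dual_counitl dual_counitr dual_comul1 dual_comulM
  dual_counit1 dual_counitM dual_antipodel dual_antipoder.

End Dual.

Section HopfMorphism.
Variables (F : fieldType) (A B : hopfType F).

Definition hopf_morph (f : 'Hom(A, B)) : Prop :=
  [/\ f 1 = 1,
      forall x y, f (x * y) = f x * f y,
      forall x, comul (f x) = tmap f f (comul x),
      forall x, counit (f x) = counit x
    & forall x, antipode (f x) = f (antipode x)].

(* f is a Hopf algebra morphism from A^cop to B; the antipode of A^cop is the
   inverse of that of A. *)
Definition hopf_cop_morph (f : 'Hom(A, B)) : Prop :=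
  [/\ f 1 = 1,
      forall x y, f (x * y) = f x * f y,
      forall x, comul (f x) = tmap f f (tswap (comul x)),
      forall x, counit (f x) = counit x
    & forall x, antipode (f (antipode x)) = f x].

End HopfMorphism.

Section Quasitriangular.
Variables (F : fieldType) (A : hopfType F) (r : tens A A).

(* r12, r13 and r23 live in (A ⊗ A) ⊗ A. *)
Definition leg12 : tens (tens A A) A := r ⊗ 1.
Definition leg13 : tens (tens A A) A := tlift (fun a b => (a ⊗ 1) ⊗ b) r.
Definition leg23 : tens (tens A A) A := tlift (fun a b => (1 ⊗ a) ⊗ b) r.

Definition quasitriangular : Prop :=
  [/\ r \is a GRing.unit,
      forall x, r * comul x = tswap (comul x) * r,
      tmap comul \1%VF r = leg13 * leg23
    & tmap \1%VF comul r = tassoc (leg13 * leg12)].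

End Quasitriangular.

(* The Drinfeld double is taken as defined by its characterization, which
   determines it up to isomorphism; dblR is \sum_i h_i ⊗ h_i^*. *)
Record drinfeldDouble (F : fieldType) (H : hopfType F) := DrinfeldDouble {
  dbl :> hopfType F;
  dblH : 'Hom(H, dbl);
  dblHd : 'Hom(dual H, dbl);
  dblH_inj : injective dblH;
  dblHd_inj : injective dblHd;
  dblH_morph : hopf_morph dblH;
  dblHd_morph : hopf_cop_morph dblHd;
  dbl_bij : bijective (tlift (fun (f : dual H) (x : H) => dblHd f * dblH x));
  dbl_qt : quasitriangular
    (\sum_(i < \dim {:H}) dblH (vbasis {:H})`_i ⊗ dblHd (dbasis i))
}.

Section DoubleElements.
Variables (F : fieldType) (H : hopfType F) (D : drinfeldDouble H).

Definition dblR : tens D D :=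
  \sum_(i < \dim {:H}) dblH D (vbasis {:H})`_i ⊗ dblHd D (dbasis i).

Definition drinfeld_elt : D :=
  \sum_(i < \dim {:H}) antipode (dblHd D (dbasis i)) * dblH D (vbasis {:H})`_i.

End DoubleElements.

Definition lfun_iter (F : fieldType) (V : vectType F) (f : 'End(V)) (n : nat) :
  'End(V) := iter n (comp_lfun f) \1%VF.

Definition Rpow (F : fieldType) (H : hopfType F) (D : drinfeldDouble H)
    (n : nat) : tens D D :=
  \prod_(i < n) tmap \1%VF (lfun_iter antipode (2 * i)) (dblR D).

(* tpow V n, mulpow A n, comulpow H n and twist H n are V^{⊗ n+1}, m_{n+1},
   Δ_{n+1} and Id ⊗ S^{-2} ⊗ ... ⊗ S^{-2n}. *)
Fixpoint tpow (F : fieldType) (V : vectType F) (n : nat) : vectType F :=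
  if n is n'.+1 then tens (tpow V n') V else V.

Fixpoint mulpow (F : fieldType) (A : falgType F) (n : nat) :
    'Hom(tpow A n, A) :=
  match n return 'Hom(tpow A n, A) with
  | 0 => \1%VF
  | n'.+1 => (mulm \o tmap (mulpow A n') \1)%VF
  end.

Fixpoint comulpow (F : fieldType) (H : hopfType F) (n : nat) :
    'Hom(H, tpow H n) :=
  match n return 'Hom(H, tpow H n) with
  | 0 => \1%VF
  | n'.+1 => (tmap (comulpow H n') \1 \o comul)%VF
  end.

Fixpoint twist (F : fieldType) (H : hopfType F) (n : nat) : 'End(tpow H n) :=
  match n return 'End(tpow H n) with
  | 0 => \1%VF
  | n'.+1 => tmap (twist H n') (lfun_iter (antipode^-1)%VF (2 * n'.+1))
  end.

Definition Tpow (F : fieldType) (H : hopfType F) (n : nat) : 'End(H) :=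
  if n is n'.+1 then (mulpow H n' \o (twist H n' \o comulpow H n'))%VF
  else linfun (fun h : H => (counit h : F)%:A).

Definition unipotent (A : nzRingType) (x : A) : Prop :=
  exists2 N : nat, (0 < N)%N & (1 - x) ^+ N = 0.

(* The least positive n satisfying P, and 0 when there is none. *)
Definition least_pos (P : nat -> Prop) : nat :=
  match pselect (exists n, `[< (0 < n)%N /\ P n >]) with
  | left exP => ex_minn exP
  | right _ => 0
  end.

Lemma least_posP (P : nat -> Prop) :
  (exists2 n, (0 < n)%N & P n) ->
  [/\ (0 < least_pos P)%N, P (least_pos P)
    & forall n, (0 < n)%N -> P n -> (least_pos P <= n)%N].
Proof.
case=> n n0 Pn; rewrite /least_pos; case: pselect => [exP|]; last first.
  by case; exists n; apply/asboolP.
case: ex_minnP => m /asboolP[m0 Pm] mP; split=> // k k0 Pk.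
by apply/mP/asboolP.
Qed.

Lemma least_pos_none (P : nat -> Prop) :
  ~ (exists2 n, (0 < n)%N & P n) -> least_pos P = 0.
Proof.
move=> nP; rewrite /least_pos; case: pselect => // exP; exfalso.
by case: exP => n /asboolP[n0 Pn]; apply: nP; exists n.
Qed.

Definition qexp (F : fieldType) (H : hopfType F) (D : drinfeldDouble H) : nat :=
  least_pos (fun n => unipotent (drinfeld_elt D ^+ n)).

Definition altsum_vanishes (F : fieldType) (V : lmodType F) (a : nat -> V)
    (n : nat) : Prop :=
  exists2 N : nat, (0 < N)%N &
    \sum_(k < N.+1) ((-1) ^+ k * 'C(N, k)%:R) *: a (n * k)%N = 0.

(* Main.v *)
Require Import Defs.
From mathcomp Require Import all_boot all_order all_algebra all_field.
From mathcomp Require Import reals complex.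
From mathcomp Require Import boolp.
Set Implicit Arguments.
Unset Strict Implicit.
Unset Printing Implicit Defensive.
Import GRing.Theory.
Local Open Scope ring_scope.

(** Write a_i, b_i for dual bases of H and of its dual, both seen inside D,
    S for the antipode of D, T_n and R_n for the two sequences of the theorem,
    and u for the Drinfeld element.  The three sequences T_n, R_n and u^n are
    images of one another under injective linear maps.  An endomorphism f of
    H gives a tensor and an element of D,

      Theta(f) = \sum_i f(a_i) ⊗ b_i,   Psi(f) = \sum_i S(b_i) f(a_i).

    Both maps are linear and injective: Theta because H and its dual embed in
    D, Psi because moreover S is injective on the dual of H and the
    multiplication of the dual of H with H is an isomorphism onto D.  One has
    Theta(T_n) = R_n (Rpow_casimir) and Psi(T_n) = u^n
    (drinfeld_exp_casimir).  Hence, for each N, the alternating sums of the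
    R_{nk} and of the T_{nk} vanish together with that of the u^{nk}, which is
    (1 - u^n)^N by the binomial formula; so either sum vanishes for some N if
    and only if u^n is unipotent (altsum_TpowP, altsum_RpowP).

    Both identities are proved by induction from the recursion
    T_{n+1} = T_n * S^{-2n} for the convolution product of endomorphisms
    (TpowS).  The canonical element turns a convolution into a product over
    two copies of the dual bases (casimir_sum_conv), which gives the identity
    for R_n at once.  For u it gives
    Psi(f * g) = \sum_j S(b_j) Psi(f) g(a_j), because S reverses products
    (antipodeM), and the powers of u can be moved past the elements of H since
    u x = S^2(x) u (drinfeld_eltC), a consequence of
    R Delta(x) = Delta^op(x) R.

    Finally, the positive n with u^n unipotent are the multiples of the least
    one, by Euclidean division (unipotent_exp_dvd).  The convention that the
    least element of an empty set is 0 agrees with this, as 0 divides no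
    positive integer. *)

(** * Linear maps out of a tensor product *)
Section Tlift.
Variable F : fieldType.
Implicit Types U V W X : vectType F.

Lemma eq_tlift U V W (b b' : U -> V -> W) t :
  (forall u v, b u v = b' u v) -> tlift b t = tlift b' t.
Proof.
by move=> bb'; rewrite !tliftEmx; apply: eq_bigr => i _; apply: eq_bigr => j _;
  rewrite bb'.
Qed.

(** For every b, tlift b is a double sum over bases, so linear maps pass
    through it; bilinearity of b only matters when a pure tensor is
    evaluated. *)
Lemma linear_tlift U V W X (l : W -> X) (b : U -> V -> W) t :
  linear l -> l (tlift b t) = tlift (fun u v => l (b u v)) t.
Proof.
move=> lL; rewrite !tliftEmx -(linfun_linear lL) linear_sum.
apply: eq_bigr => i _; rewrite linear_sum; apply: eq_bigr => j _.
by rewrite linearZ /= linfun_linear.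
Qed.

(** Used to check the multilinearity of forms that contain a nested tlift. *)
Lemma tlift_linear_param U V W X (b : X -> U -> V -> W) t :
  (forall u v, linear (fun x => b x u v)) -> linear (fun x => tlift (b x) t).
Proof.
move=> bL k x y; rewrite !tliftEmx scaler_sumr -big_split.
apply: eq_bigr => i _; rewrite scaler_sumr -big_split; apply: eq_bigr => j _ /=.
by rewrite bL scalerDr !scalerA mulrC.
Qed.

End Tlift.

(** * Sweedler calculus and the antipode *)

(** An expression in Sweedler notation, the sum of b(x_1, x_2), is encoded as
    tlift b (comul x); iterated coproducts become nested tlifts.  The tactic
    proves that such expressions, built from products and linear maps, are
    linear in one of their variables. *)
Ltac lin := let k := fresh "k" in move=> k ? ? /=;
  do 3! rewrite ?(linearP, mulrDl, mulrDr, scalerDr) /= -?scalerAl -?scalerAr;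
  rewrite ?(mulrDl, mulrDr) -?scalerAl -?scalerAr.

Section HopfIdentities.
Variables (F : fieldType) (A : hopfType F).
Implicit Types (x y : A) (W : vectType F).
Local Notation S := (@antipode F A).

Lemma tlift_comulA W (t : A -> A -> A -> W) x :
  (forall b c, linear (fun a => t a b c)) ->
  (forall a c, linear (fun b => t a b c)) ->
  (forall a b, linear (t a b)) ->
  tlift (fun a c => tlift (fun p q => t p q c) (comul a)) (comul x) =
  tlift (fun a c => tlift (t a) (comul c)) (comul x).
Proof.
move=> tL1 tL2 tL3.
have bL : bilin (fun (s : tens A A) c => tlift (fun p q => t p q c) s).
  split=> [s|c]; last by move=> k u v; rewrite linearP.
  by apply: tlift_linear_param => u v; exact: tL3.
have bR : bilin (fun a (s : tens A A) => tlift (t a) s).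
  split=> [a|s]; first by move=> k u v; rewrite linearP.
  by apply: tlift_linear_param => u v; exact: tL1.
have HL s : tlift (fun a c => tlift (fun p q => t p q c) (comul a)) s =
    tlift (fun (s : tens A A) c => tlift (fun p q => t p q c) s)
      (tmap comul \1%VF s).
  elim/tens_ind: s => [a c|s s' IH IH']; last by rewrite !linearD /= IH IH'.
  rewrite tmapE id_lfunE (tliftE _ _ bL) tliftE //; split=> [u k v w|u k v w].
    exact: bL.1.
  by rewrite linearP; exact: bL.2.
have HR s : tlift (fun a c => tlift (t a) (comul c)) s =
    tlift (fun a (s : tens A A) => tlift (t a) s) (tmap \1%VF comul s).
  elim/tens_ind: s => [a c|s s' IH IH']; last by rewrite !linearD /= IH IH'.
  rewrite tmapE id_lfunE (tliftE _ _ bR) tliftE //; split=> [u k v w|u k v w].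
    by rewrite linearP; exact: bR.1.
  exact: bR.2.
rewrite HL HR -comulA.
elim/tens_ind: (tmap _ _ _) => [s c|s s' IH IH']; last first.
  by rewrite !linearD /= IH IH'.
elim/tens_ind: s => [a b|s s' IH IH']; last first.
  by rewrite tpureDl !linearD /= IH IH'.
rewrite tassocE (tliftE _ _ bL) (tliftE _ _ bR) !tliftE //.
Qed.

Lemma tlift_counitl W (g : A -> W) x : linear g ->
  tlift (fun a b => (counit a : F) *: g b) (comul x) = g x.
Proof.
move=> gL; rewrite -[in RHS](counitl x) (linear_tlift _ _ gL).
by apply: eq_tlift => a b; rewrite -!(linfun_linear gL) linearZ.
Qed.

Lemma tlift_counitr W (g : A -> W) x : linear g ->
  tlift (fun a b => (counit b : F) *: g a) (comul x) = g x.
Proof.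
move=> gL; rewrite -[in RHS](counitr x) (linear_tlift _ _ gL).
by apply: eq_tlift => a b; rewrite -!(linfun_linear gL) linearZ.
Qed.

Lemma bilin_mul (B : falgType F) (U V : vectType F) (f : U -> B) (g : V -> B) :
  linear f -> linear g -> bilin (fun a b => f a * g b).
Proof.
move=> fL gL; split=> [u k v w|u k v w].
  by rewrite gL mulrDr scalerAr.
by rewrite fL mulrDl scalerAl.
Qed.

Lemma mulm_tmap (f g : 'End(A)) t :
  mulm (tmap f g t) = tlift (fun a b => f a * g b) t.
Proof.
elim/tens_ind: t => [a b|s t IHs IHt]; last by rewrite !linearD /= IHs IHt.
rewrite tmapE mulmE tliftE //.
by apply: bilin_mul => k u v; rewrite linearP.
Qed.

Lemma tlift_antipodel x :
  tlift (fun a b => S a * b) (comul x) = (counit x : F)%:A.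
Proof.
by rewrite -antipodel mulm_tmap; apply: eq_tlift => a b; rewrite id_lfunE.
Qed.

Lemma tlift_antipoder x :
  tlift (fun a b => a * S b) (comul x) = (counit x : F)%:A.
Proof.
by rewrite -antipoder mulm_tmap; apply: eq_tlift => a b; rewrite id_lfunE.
Qed.

Lemma antipode1 : S 1 = 1.
Proof.
have := antipodel (1 : A).
by rewrite comul1 tmapE mulmE id_lfunE mulr1 counit1 scale1r.
Qed.

Lemma tlift_comulM W (b : A -> A -> W) x y : bilin b ->
  tlift b (comul (x * y)) =
  tlift (fun p q => tlift (fun r s => b (p * r) (q * s)) (comul y)) (comul x).
Proof.
move=> bb; rewrite comulM.
elim/tens_ind: (comul x) => [p q|s t IHs IHt]; last first.
  by rewrite mulrDl !linearD /= IHs IHt.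
rewrite tliftE; last first.
  split=> u; apply: tlift_linear_param => v w k c d.
    by rewrite mulrDl -scalerAl bb.1.
  by rewrite mulrDl -scalerAl bb.2.
elim/tens_ind: (comul y) => [r z|s t IHs IHt]; last first.
  by rewrite mulrDr !linearD /= IHs IHt.
rewrite tensE !tliftE //; split=> u k v w.
  by rewrite mulrDr -scalerAr bb.1.
by rewrite mulrDr -scalerAr bb.2.
Qed.

(** The half of the antimultiplicativity of S that treats the first factor.
    In S(x_1) x_2 y_1 S(x_3 y_2) the first two factors contract to a counit,
    leaving the left-hand side, and the rest is the antipode axiom for the
    product x_2 y, leaving the right-hand side. *)
Lemma antipode_peel x y :
  tlift (fun r s => r * S (x * s)) (comul y) = (counit y : F) *: S x.
Proof.
pose t (p q r : A) : A :=
  tlift (fun c d : A => S p * q * c * S (r * d)) (comul y).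
have tL1 b c : linear (fun a => t a b c).
  by rewrite /t; apply: tlift_linear_param => u v; lin.
have tL2 a c : linear (fun b => t a b c).
  by rewrite /t; apply: tlift_linear_param => u v; lin.
have tL3 a b : linear (t a b).
  by rewrite /t; apply: tlift_linear_param => u v; lin.
have E := tlift_comulA x tL1 tL2 tL3; rewrite /t in E.
transitivity
  (tlift (fun a c => (counit a : F) *:
     tlift (fun r s => r * S (c * s)) (comul y)) (comul x)).
  rewrite tlift_counitl //.
  by rewrite /t; apply: tlift_linear_param => u v; lin.
transitivity (tlift (fun a c =>
    (counit c : F) *: ((counit y : F) *: S a)) (comul x)); last first.
  by rewrite tlift_counitr //; lin; rewrite !scalerA mulrC.
transitivity (tlift (fun a c => tlift
   (fun p q => tlift (fun v w => S p * q * v * S (c * w)) (comul y))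
      (comul a)) (comul x)).
  apply: eq_tlift => a c.
  rewrite -[LHS]mul1r -scalerAr scalerAl -tlift_antipodel.
  rewrite (@linear_tlift _ _ _ _ _ (fun z => z * _)); last by lin.
  apply: eq_tlift => p q; rewrite linear_tlift; last by lin.
  by apply: eq_tlift => u v; rewrite !mulrA.
rewrite E; apply: eq_tlift => a c.
transitivity (S a * tlift (fun q r =>
    tlift (fun u v => (q * u) * S (r * v)) (comul y)) (comul c)).
  rewrite linear_tlift; last by lin.
  apply: eq_tlift => p q; rewrite linear_tlift; last by lin.
  by apply: eq_tlift => u v; rewrite !mulrA.
rewrite -(@tlift_comulM _ (fun p q => p * S q)); last first.
  by apply: bilin_mul; lin.
rewrite tlift_antipoder counitM scalerA.
by rewrite -scalerAr mulr1.
Qed.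

(** In S(y_1) y_2 S(x y_3) the first two factors contract to a counit, leaving
    S(x y), and the last two contract to S(x) by antipode_peel. *)
Lemma antipodeM x y : S (x * y) = S y * S x.
Proof.
pose t (p q r : A) : A := S p * q * S (x * r).
have tL1 b c : linear (fun a => t a b c) by rewrite /t; lin.
have tL2 a c : linear (fun b => t a b c) by rewrite /t; lin.
have tL3 a b : linear (t a b) by rewrite /t; lin.
have E := tlift_comulA y tL1 tL2 tL3; rewrite /t in E.
transitivity (tlift (fun a c => (counit a : F) *: S (x * c)) (comul y)).
  by rewrite tlift_counitl //; lin.
transitivity (tlift (fun a c => (counit c : F) *: (S a * S x)) (comul y));
  last first.
  by rewrite tlift_counitr //; lin.
transitivity (tlift (fun a c =>
    tlift (fun p q => S p * q * S (x * c)) (comul a)) (comul y)).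
  apply: eq_tlift => a c.
  rewrite -[LHS]mul1r -scalerAr scalerAl -tlift_antipodel.
  by rewrite (@linear_tlift _ _ _ _ _ (fun z => z * _)) //; lin.
rewrite E; apply: eq_tlift => a c.
transitivity (S a * tlift (fun q r => q * S (x * r)) (comul c)).
  rewrite linear_tlift; last by lin.
  by apply: eq_tlift => p q; rewrite mulrA.
by rewrite antipode_peel -scalerAr.
Qed.

End HopfIdentities.

(** * The canonical element of a vector space and its dual *)
Section DualBases.
Variables (F : fieldType) (H : hopfType F).
Local Notation e := (vbasis {:H}).

Definition convolution (f g : 'End(H)) : 'End(H) :=
  (mulm \o (tmap f g \o comul))%VF.

(** The image of the canonical element of dual H ⊗ H under id ⊗ f followed by
    b.  Both Theta and Psi of the introduction are instances. *)
Definition casimir (W : vectType F) (b : dual H -> H -> W) (f : 'End(H)) : W :=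
  \sum_k b (dbasis k) (f e`_k).

Lemma dbasisM i j x : (dbasis i * dbasis j : dual H) x = comul x i j.
Proof.
rewrite comp_lfunE; elim/tens_ind: (comul x) => [a b|s t IHs IHt].
  by rewrite tevE !mxE !dbasisE.
by rewrite linearD /= IHs IHt mxE.
Qed.

(** The product of the dual is the transpose of the coproduct: both sides
    expand in the coefficients of the coproducts of the basis vectors. *)
Lemma casimir_sum_conv (W : vectType F) (b : dual H -> H -> W) f g : bilin b ->
  casimir b (convolution f g) =
  \sum_i \sum_j b (dbasis i * dbasis j) (f e`_i * g e`_j).
Proof.
move=> [bL bR].
transitivity (\sum_(k < \dim {:H}) \sum_i \sum_j comul e`_k i j *:
    b (dbasis k) (f e`_i * g e`_j)).
  apply: eq_bigr => k _; rewrite !comp_lfunE mulm_tmap.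
  by rewrite (linear_tlift _ _ (bL _)) tliftEmx.
rewrite exchange_big /=; apply: eq_bigr => i _.
rewrite exchange_big /=; apply: eq_bigr => j _.
rewrite [in RHS](dual_coord (dbasis i * dbasis j)).
rewrite (linear_sumZ _ _ (bR _)).
by apply: eq_bigr => k _; rewrite dbasisM.
Qed.

(** The canonical element is invariant: an endomorphism may be moved from its
    first leg, as a transpose, to its second leg. *)
Lemma casimir_comp (W : vectType F) (b : dual H -> H -> W) (f phi : 'End(H)) :
  bilin b ->
  \sum_k b ((dbasis k : 'Hom(H, F^o)) \o phi)%VF (f e`_k) =
  casimir b (f \o phi)%VF.
Proof.
move=> [bL bR].
transitivity (\sum_(k < \dim {:H}) \sum_(l < \dim {:H})
    coord e k (phi e`_l) *: b (dbasis l) (f e`_k)).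
  apply: eq_bigr => k _.
  rewrite [X in b X _](dual_coord (_ : dual H)) (linear_sumZ _ _ (bR _)).
  by apply: eq_bigr => l _; rewrite comp_lfunE dbasisE.
rewrite exchange_big /=; apply: eq_bigr => l _.
rewrite comp_lfunE {2}(coord_fullv (phi e`_l)) linear_sum.
under [in RHS]eq_bigr do rewrite linearZ /=.
by rewrite (linear_sumZ _ _ (bL _)).
Qed.

(** Serves for T_0, which is the counit times 1. *)
Lemma casimir_rank1 (W : vectType F) (b : dual H -> H -> W)
    (f : 'End(H)) (phi : dual H) h :
  bilin b -> (forall x, f x = (phi x : F) *: h) -> casimir b f = b phi h.
Proof.
move=> [bL bR] fE; rewrite [in RHS](dual_coord phi) (linear_sumZ _ _ (bR _)).
apply: eq_bigr => k _; rewrite fE -(linfun_linear (bL _)) linearZ /=.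
by rewrite linfun_linear.
Qed.

Lemma casimir_linear (W : vectType F) (b : dual H -> H -> W) : bilin b ->
  linear (casimir b).
Proof.
move=> [bL bR] k f g; rewrite /casimir scaler_sumr -big_split.
by apply: eq_bigr => i _ /=; rewrite add_lfunE scale_lfunE bL.
Qed.

Lemma casimir_tens_inj :
  injective (casimir (fun (phi : dual H) (h : H) => phi ⊗ h)).
Proof.
move=> f g fg; apply/lfunP => x.
have evE h :
    evl H x (casimir (fun (phi : dual H) (h : H) => phi ⊗ h) h) = h x.
  rewrite /casimir linear_sum [in RHS](coord_fullv x) linear_sum.
  by apply: eq_bigr => i _ /=; rewrite evlE linearZ dbasisE.
by rewrite -!evE fg.
Qed.

End DualBases.

(** * The maps T_n as convolution powers *)
Section Powers.
Variables (F : fieldType) (H : hopfType F).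

Lemma lfun_iterSr (V : vectType F) (f : 'End(V)) n :
  lfun_iter f n.+1 = (lfun_iter f n \o f)%VF.
Proof.
elim: n => [|n IHn]; first by rewrite /lfun_iter /= comp_lfun1r comp_lfun1l.
by rewrite -[LHS]/(f \o lfun_iter f n.+1)%VF {1}IHn comp_lfunA.
Qed.

Lemma Tpow0E x : Tpow H 0 x = (counit x : F)%:A.
Proof.
by rewrite linfun_linear // => k y z; rewrite linearP scalerDl -scalerA.
Qed.

Lemma TpowS n :
  Tpow H n.+1 = convolution (Tpow H n) (lfun_iter (antipode^-1)%VF (2 * n)).
Proof.
case: n => [|n]; apply/lfunP => x.
  rewrite !comp_lfunE mulm_tmap.
  rewrite !id_lfunE -[LHS](@tlift_counitl _ _ _ id) //.
  apply: eq_tlift => a b; rewrite Tpow0E id_lfunE.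
  by rewrite -scalerAl mul1r.
pose L : 'Hom(tens H H, H) :=
  (mulm \o (tmap (mulpow H n) \1 \o
    (tmap (twist H n) (lfun_iter (antipode^-1) (2 * n.+1)) \o tmap (comulpow H n) \1)))%VF.
have -> : Tpow H n.+2 = (L \o comul)%VF.
  by rewrite /L -!comp_lfunA; exact: esym (comp_lfunA _ _ _).
rewrite /convolution comp_lfunA.
have -> // : L = (mulm \o
    tmap (Tpow H n.+1) (lfun_iter (antipode^-1) (2 * n.+1)))%VF.
apply: tens_lfunP => a b; rewrite /L 3!comp_lfunE [RHS]comp_lfunE !tmapE !mulmE.
by rewrite !id_lfunE /Tpow !comp_lfunE.
Qed.

End Powers.

(** * The Drinfeld double *)
Section Double.
Variables (F : fieldType) (H : hopfType F) (D : drinfeldDouble H).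
Local Notation e := (vbasis {:H}).
Local Notation S := (@antipode F D).
Local Notation SH := (@antipode F H).
Local Notation iH := (dblH D).
Local Notation iHd := (dblHd D).
Local Notation u := (drinfeld_elt D).

Let iHM x y : iH (x * y) = iH x * iH y.
Proof. by case: (dblH_morph D). Qed.
Let iHdM f g : iHd (f * g) = iHd f * iHd g.
Proof. by case: (dblHd_morph D). Qed.
Let iHS x : S (iH x) = iH (SH x).
Proof. by case: (dblH_morph D). Qed.

(** On the dual of H the antipode is injective because the double contains
    the dual with opposite coproduct, whose antipode inverts it.  By finite
    dimension it is onto, so that the coordinates on H, hence its points, can
    be recovered from their images under the antipode of H. *)
Lemma lker_antipode : lker SH == 0%VS.
Proof.
have injSd : lker (@antipode F (dual H)) == 0%VS.
  case: (dblHd_morph D) => _ _ _ _ SS; apply/lker0P => f g fg.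
  by apply: (dblHd_inj (d := D)); rewrite -SS fg SS.
apply/lker0P => x y xy.
rewrite (coord_fullv x) (coord_fullv y); apply: eq_bigr => i _; congr (_ *: _).
rewrite -!dbasisE -(lker0_lfunVK injSd (dbasis i)).
by rewrite !dual_antipodeE xy.
Qed.

Lemma antipode_dblHd (f : dual H) :
  S (iHd f) = iHd ((f : 'Hom(H, F^o)) \o SH^-1)%VF.
Proof.
case: (dblHd_morph D) => _ _ _ _ SS; rewrite -[RHS]SS; congr (S (iHd _)).
apply/lfunP => x; rewrite dual_antipodeE comp_lfunE.
by rewrite lker0_lfunK // lker_antipode.
Qed.

Lemma antipode_iter_dblHd (f : dual H) n :
  lfun_iter S n (iHd f) = iHd ((f : 'Hom(H, F^o)) \o lfun_iter SH^-1 n)%VF.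
Proof.
elim: n => [|n IHn]; first by rewrite /lfun_iter /= id_lfunE comp_lfun1r.
rewrite {1}/lfun_iter iterS -/(lfun_iter _ _) comp_lfunE IHn antipode_dblHd.
by rewrite lfun_iterSr comp_lfunA.
Qed.

Definition rmx_form (f : dual H) (h : H) : tens D D := iH h ⊗ iHd f.
Definition drinfeld_form (f : dual H) (h : H) : D := S (iHd f) * iH h.

Lemma bilin_rmx_form : bilin rmx_form.
Proof.
split=> v k x y; rewrite /rmx_form linearP /=.
  by rewrite tpureDl tpureZl.
by rewrite tpureDr tpureZr.
Qed.

Lemma bilin_drinfeld_form : bilin drinfeld_form.
Proof. by apply: bilin_mul => k x y; rewrite !linearP. Qed.

Lemma Rpow_casimir n : Rpow D n = casimir rmx_form (Tpow H n).
Proof.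
elim: n => [|n IHn].
  rewrite /Rpow big_ord0 (casimir_rank1 bilin_rmx_form (@Tpow0E _ _)).
  have [iH1 _ _ _ _] := dblH_morph D; have [iHd1 _ _ _ _] := dblHd_morph D.
  by rewrite /rmx_form iH1 [iHd _]iHd1.
rewrite TpowS casimir_sum_conv; last exact: bilin_rmx_form.
rewrite /Rpow big_ord_recr /= -/(Rpow D n) IHn.
have -> : tmap \1%VF (lfun_iter S (2 * n)) (dblR D) =
    casimir rmx_form (lfun_iter SH^-1 (2 * n)).
  rewrite -[X in casimir _ X]comp_lfun1l -casimir_comp;
    last exact: bilin_rmx_form.
  rewrite linear_sum; apply: eq_bigr => k _ /=.
  by rewrite tmapE !id_lfunE antipode_iter_dblHd.
rewrite /casimir mulr_suml; apply: eq_bigr => i _.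
rewrite mulr_sumr; apply: eq_bigr => j _.
by rewrite /rmx_form tensE iHM iHdM.
Qed.

(** Both legs can be mapped back to H and its dual. *)
Lemma casimir_rmx_form_inj : injective (casimir rmx_form).
Proof.
move=> f g fg; apply: casimir_tens_inj.
have inj1 : lker iH == 0%VS by apply/lker0P; exact: dblH_inj.
have inj2 : lker iHd == 0%VS by apply/lker0P; exact: dblHd_inj.
have E h : tswap (tmap iH^-1 iHd^-1 (casimir rmx_form h)) =
    casimir (fun (phi : dual H) (h : H) => phi ⊗ h) h.
  rewrite !linear_sum; apply: eq_bigr => k _ /=.
  by rewrite tmapE tswapE !lker0_lfunK.
by rewrite -!E fg.
Qed.

(** Psi is the multiplication of the dual of H with H, a bijection onto the
    double, after the transpose L of the inverse of the antipode of H. *)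
Lemma casimir_drinfeld_form_inj : injective (casimir drinfeld_form).
Proof.
move=> f g fg; apply: casimir_tens_inj.
pose c h := casimir (fun (phi : dual H) (x : H) => phi ⊗ x) h.
pose L : 'End(dual H) :=
  linfun (fun phi : dual H => ((phi : 'Hom(H, F^o)) \o SH^-1)%VF : dual H).
have LE phi : L phi = ((phi : 'Hom(H, F^o)) \o SH^-1)%VF.
  by rewrite linfun_linear // => a b d; rewrite comp_lfunDl comp_lfunZl.
have L0 : lker L == 0%VS.
  apply/lker0P => phi psi; rewrite !LE.
  move=> /(congr1 (fun f : 'Hom(H, F^o) => (f \o SH)%VF)).
  by rewrite -!comp_lfunA lker0_compVf ?lker_antipode // !comp_lfun1r.
have uE h : tlift (fun (f : dual H) (x : H) => iHd f * iH x)
    (tmap L \1%VF (c h)) = casimir drinfeld_form h.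
  rewrite !linear_sum; apply: eq_bigr => k _ /=.
  rewrite tmapE tliftE; last by apply: bilin_mul => a b d; rewrite linearP.
  by rewrite id_lfunE /drinfeld_form antipode_dblHd LE.
have LK t : tmap (L^-1)%VF \1%VF (tmap L \1%VF t) = t :> tens (dual H) H.
  elim/tens_ind: t => [a b|s t IHs IHt]; last by rewrite !linearD /= IHs IHt.
  by rewrite !tmapE lker0_lfunK // !id_lfunE.
rewrite -/(c f) -/(c g) -(LK (c f)) -(LK (c g)); congr (tmap _ _ _).
by apply: (bij_inj (dbl_bij D)); rewrite !uE.
Qed.

(** Apply p ⊗ q |-> S(q) p to the two sides of R Delta(x) = Delta^op(x) R:
    the first gives S(x_2) u x_1, and in the second S(x_1) x_2 appears between
    the legs of R. *)
Lemma tlift_drinfeld_elt (x : D) :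
  tlift (fun a b => S b * u * a) (comul x) = (counit x : F) *: u.
Proof.
pose M : 'Hom(tens D D, D) := tlift (fun p q => S q * p).
have ME p q : M (p ⊗ q) = S q * p.
  by rewrite /M tliftE //; split=> v; lin.
have [_ RD _ _] := dbl_qt D; rewrite -/(dblR D) in RD.
transitivity (M (dblR D * comul x)).
  elim/tens_ind: (comul x) => [a b|s t IHs IHt]; last first.
    by rewrite mulrDr !linearD /= IHs IHt.
  rewrite tliftE; last first.
    by split=> v; lin.
  rewrite mulr_suml linear_sum mulr_sumr mulr_suml; apply: eq_bigr => k _ /=.
  by rewrite tensE ME antipodeM !mulrA.
rewrite RD.
transitivity (\sum_(k < \dim {:H}) S (iHd (dbasis k)) *
    tlift (fun a b => S a * b) (comul x) * iH e`_k); last first.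
  rewrite scaler_sumr; apply: eq_bigr => k _.
  by rewrite tlift_antipodel -scalerAr mulr1 -scalerAl.
elim/tens_ind: (comul x) => [a b|s t IHs IHt]; last first.
  rewrite linearD mulrDl linearD /= IHs IHt -big_split.
  by apply: eq_bigr => k _ /=; rewrite linearD mulrDr mulrDl.
rewrite tswapE mulr_sumr linear_sum; apply: eq_bigr => k _ /=.
rewrite tensE ME antipodeM tliftE ?mulrA //.
by apply: bilin_mul => k' y z; rewrite ?linearP.
Qed.

(** Evaluate S^2(x_3) S(x_2) u x_1 in two ways: the factors S(x_2) u x_1
    contract to u by the previous lemma, and S^2(x_3) S(x_2) = S(x_2 S(x_3))
    contracts to a scalar. *)
Lemma drinfeld_eltC (x : D) : u * x = S (S x) * u.
Proof.
pose t (a b c : D) : D := S (S c) * S b * u * a.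
have tL1 b c : linear (fun a => t a b c) by rewrite /t; lin.
have tL2 a c : linear (fun b => t a b c) by rewrite /t; lin.
have tL3 a b : linear (t a b) by rewrite /t; lin.
have E := tlift_comulA x tL1 tL2 tL3; rewrite /t in E.
transitivity (tlift (fun a c => (counit c : F) *: (u * a)) (comul x)).
  by rewrite (@tlift_counitr _ _ _ (fun a => u * a)) //; lin.
transitivity (tlift (fun a c => (counit a : F) *: (S (S c) * u)) (comul x));
  last first.
  by rewrite (@tlift_counitl _ _ _ (fun c => S (S c) * u)) //; lin.
symmetry.
transitivity (tlift (fun a c =>
    tlift (fun p q => S (S c) * S q * u * p) (comul a)) (comul x)).
  apply: eq_tlift => a c; rewrite scalerAr -tlift_drinfeld_elt.
  rewrite linear_tlift; last by lin.
  by apply: eq_tlift => p q; rewrite !mulrA.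
rewrite E; apply: eq_tlift => a c.
transitivity (S (tlift (fun q r => q * S r) (comul c)) * u * a).
  rewrite (linear_tlift (l := fun z => S z * u * a)); last by lin.
  by apply: eq_tlift => p q; rewrite antipodeM.
by rewrite tlift_antipoder linearZ /= antipode1 -!scalerAl mul1r.
Qed.

(** Each factor u that passes y applies S^2 to it, cancelling one S^{-2}. *)
Lemma drinfeld_exp_commute n (y : H) :
  u ^+ n * iH (lfun_iter SH^-1 (2 * n) y) = iH y * u ^+ n.
Proof.
elim: n y => [|n IHn] y.
  by rewrite /lfun_iter muln0 /= id_lfunE mulr1 mul1r.
rewrite exprSr -mulrA drinfeld_eltC !iHS mulnS !addSn add0n.
rewrite /lfun_iter !iterS -/(lfun_iter _ _) !comp_lfunE.
by rewrite !lker0_lfunVK ?lker_antipode // mulrA IHn mulrA.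
Qed.

(** In the inductive step the sum over the first copy of the dual bases is
    Psi(T_n) = u^n, caught between S(b_j) and S^{-2n}(a_j); moving it to the
    right turns the sum over the second copy into u. *)
Lemma drinfeld_exp_casimir n : u ^+ n = casimir drinfeld_form (Tpow H n).
Proof.
elim: n => [|n IHn].
  rewrite (casimir_rank1 bilin_drinfeld_form (@Tpow0E _ _)).
  have [iH1 _ _ _ _] := dblH_morph D; have [iHd1 _ _ _ _] := dblHd_morph D.
  by rewrite /drinfeld_form iH1 [iHd _]iHd1 antipode1 mulr1.
rewrite TpowS casimir_sum_conv; last exact: bilin_drinfeld_form.
rewrite exchange_big exprS mulr_suml; apply: eq_bigr => j _ /=.
rewrite -mulrA -drinfeld_exp_commute IHn mulr_suml mulr_sumr.
by apply: eq_bigr => i _; rewrite /drinfeld_form iHdM iHM antipodeM !mulrA.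
Qed.

End Double.

(** * Unipotent powers *)
Section Unipotent.
Variables (F : fieldType) (A : algType F).
Implicit Types x y : A.

Lemma nilpotentD x y m n :
  GRing.comm x y -> x ^+ m = 0 -> y ^+ n = 0 -> (x + y) ^+ (m + n) = 0.
Proof.
move=> cxy xm yn; rewrite exprDn_comm // big1 // => i _.
have [le_ni|lt_in] := leqP n i.
  by rewrite -(subnKC le_ni) [y ^+ _]exprD yn mul0r mulr0 mul0rn.
have /subnKC <- : (m <= m + n - i)%N by rewrite -addnBA ?leq_addr // ltnW.
by rewrite exprD xm !mul0r mul0rn.
Qed.

Lemma comm_1subX x m n : GRing.comm (1 - x ^+ m) (x ^+ n).
Proof.
by apply: commr_sym; apply: commrB;
  [exact: commr1 | rewrite /GRing.comm -!exprD addnC].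
Qed.

Lemma unipotent_exp_mul x d k : unipotent (x ^+ d) -> unipotent (x ^+ (d * k)).
Proof.
move=> [N N0 xN]; exists N => //.
have -> : 1 - x ^+ (d * k) = (1 - x ^+ d) * \sum_(i < k) x ^+ d ^+ i.
  by rewrite exprM -opprB subrX1 -mulNr opprB.
rewrite exprMn_comm ?xN ?mul0r //.
by apply: commr_sum => i _; rewrite -exprM; exact: comm_1subX.
Qed.

(** With n = d q + r one has 1 - x^r = (1 - x^n) - x^r (1 - x^{d q}), a sum
    of two commuting nilpotent elements. *)
Lemma unipotent_exp_mod x d n :
  unipotent (x ^+ d) -> unipotent (x ^+ n) -> unipotent (x ^+ (n %% d)).
Proof.
move=> Ud [N N0 xN].
have [M M0 xM] := unipotent_exp_mul (n %/ d) Ud.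
exists (N + M)%N; first by rewrite addn_gt0 N0.
set r := (n %% d)%N; set q := (d * (n %/ d))%N in xM.
have -> : 1 - x ^+ r = (1 - x ^+ n) + (- x ^+ r) * (1 - x ^+ q).
  rewrite mulrBr mulr1 mulNr -exprD /r /q mulnC addnC -divn_eq opprK.
  by rewrite addrACA addNr addr0.
apply: nilpotentD => //.
  apply: commrM; first by apply: commrN; exact: comm_1subX.
  by apply: commrB; [exact: commr1 | exact: comm_1subX].
rewrite exprMn_comm ?xM ?mulr0 //.
by apply: commr_sym; apply: commrN; exact: comm_1subX.
Qed.

Lemma unipotent_exp_dvd x n : (0 < n)%N ->
  unipotent (x ^+ n) <-> (least_pos (fun k => unipotent (x ^+ k)) %| n)%N.
Proof.
move=> n0; set P := fun k => unipotent (x ^+ k); set d := least_pos P.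
have [exP|nexP] := pselect (exists2 k, (0 < k)%N & P k); last first.
  rewrite /d (least_pos_none nexP) dvd0n; split=> [Pn|/eqP n00].
    by case: nexP; exists n.
  by rewrite n00 in n0.
have [d0 Pd dmin] := least_posP exP.
split=> [Pn|/dvdnP[k ->]]; last by rewrite mulnC; exact: unipotent_exp_mul.
apply: contraT; rewrite /dvdn -lt0n => r0.
have := dmin _ r0 (unipotent_exp_mod Pd Pn).
by rewrite leqNgt ltn_mod d0.
Qed.

Lemma altsum_vanishes_exp x n :
  altsum_vanishes (fun k => x ^+ k) n <-> unipotent (x ^+ n).
Proof.
suff E N : \sum_(k < N.+1) ((-1) ^+ k * 'C(N, k)%:R : F) *: x ^+ (n * k) =
    (1 - x ^+ n) ^+ N.
  by split=> -[N N0 xN]; exists N => //; move: xN; rewrite E.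
rewrite exprBn_comm; last by apply: commr_sym; exact: commr1.
apply: eq_bigr => k _; rewrite expr1n mulr1 exprM -scalerA scaler_nat.
rewrite -signr_odd -[in RHS]signr_odd.
by case: odd; rewrite ?scaleN1r ?mulN1r ?scale1r ?mul1r ?mulNrn.
Qed.

End Unipotent.

Lemma altsum_vanishes_inj (F : fieldType) (V W : vectType F) (g : V -> W) a n :
  linear g -> injective g ->
  altsum_vanishes (g \o a) n <-> altsum_vanishes a n.
Proof.
move=> gL gI; have g0 : g 0 = 0 by rewrite -(linfun_linear gL) linear0.
split=> -[N N0 aN]; exists N => //; last first.
  by rewrite -(linear_sumZ _ _ gL) aN g0.
by apply: gI; rewrite g0 (linear_sumZ _ _ gL).
Qed.

(** * Comparison of the three sequences *)
Section Conclusion.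
Variables (F : fieldType) (H : hopfType F) (D : drinfeldDouble H).
Local Notation u := (drinfeld_elt D).

Lemma altsum_TpowP n : altsum_vanishes (Tpow H) n <-> unipotent (u ^+ n).
Proof.
rewrite -altsum_vanishes_exp.
have -> : (fun k => u ^+ k) = casimir (@drinfeld_form _ _ D) \o Tpow H.
  by apply/funext => k; exact: drinfeld_exp_casimir.
symmetry; apply: altsum_vanishes_inj; last exact: casimir_drinfeld_form_inj.
by apply: casimir_linear; exact: bilin_drinfeld_form.
Qed.

Lemma altsum_RpowP n : altsum_vanishes (Rpow D) n <-> unipotent (u ^+ n).
Proof.
rewrite -altsum_TpowP.
have -> : Rpow D = casimir (@rmx_form _ _ D) \o Tpow H.
  by apply/funext => k; exact: Rpow_casimir.
apply: altsum_vanishes_inj; last exact: casimir_rmx_form_inj.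
by apply: casimir_linear; exact: bilin_rmx_form.
Qed.

End Conclusion.

Theorem corollary2p4 (R : realType) (H : hopfType R[i]) (D : drinfeldDouble H) :
  (forall n : nat, (0 < n)%N ->
     (altsum_vanishes (Rpow D) n <-> (qexp D %| n)%N) /\
     (altsum_vanishes (Tpow H) n <-> (qexp D %| n)%N)) /\
  qexp D = least_pos (altsum_vanishes (Rpow D)) /\
  qexp D = least_pos (altsum_vanishes (Tpow H)).
Proof.
split=> [n n0|].
  rewrite altsum_RpowP altsum_TpowP.
  by split; exact: unipotent_exp_dvd.
by split; congr least_pos; apply/funext => n; apply/propext; symmetry;
  [exact: altsum_RpowP | exact: altsum_TpowP].
Qed.
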